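(* (Setting (3.b)) There is a subgroup of $\mathbb{Z}^{\mathbb{N}}$ which is Hurewicz-bounded and Menger-bounded and has the Menger property, but is not Rothberger-bounded, does not have the Hurewicz property, and does not have the Rothberger property.
   Context: The group $\mathbb{Z}^{\mathbb{N}}$ carries pointwise addition and the product topology ($\mathbb{Z}$ discrete); subgroups carry the subspace topology. For a topological group $(G,\cdot)$, with the condition required for each sequence $(U_n)_{n\in\mathbb{N}}$ of neighborhoods of the unit: $G$ is Menger-bounded if there are finite $F_n\subseteq G$ with $G=\bigcup_n F_n\cdot U_n$; Hurewicz-bounded if there are finite $F_n\subseteq G$ such that each $g\in G$ belongs to $F_n\cdot U_n$ for all but finitely many $n$; Rothberger-bounded if there are $a_n\in G$ with $G=\bigcup_n a_n\cdot U_n$. For a topological space $X$, with the condition required for each sequence $(\mathcal{U}_n)_{n\in\mathbb{N}}$ of open covers of $X$: $X$ has the Menger property if there are finite $\mathcal{F}_n\subseteq\mathcal{U}_n$ such that $\bigcup_n\mathcal{F}_n$ covers $X$; the Hurewicz property if there are finite $\mathcal{F}_n\subseteq\mathcal{U}_n$ such that each $x\in X$ belongs to $\bigcup_{U\in\mathcal{F}_n}U$ for all but finitely many $n$; the Rothberger property if there are $U_n\in\mathcal{U}_n$ with $X=\bigcup_n U_n$. *)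

(* Defs.v *)
From HB Require Import structures.
From mathcomp Require Import all_boot all_order all_algebra.
From mathcomp Require Import all_classical all_reals all_analysis.

Set Implicit Arguments.
Unset Strict Implicit.
Unset Printing Implicit Defensive.

Import GRing.Theory.
Local Open Scope classical_set_scope.
Local Open Scope ring_scope.

Definition open_cover (X : topologicalType) (C : set (set X)) : Prop :=
  C `<=` open /\ \bigcup_(A in C) A = [set: X].

Definition Menger (X : topologicalType) : Prop :=
  forall C : nat -> set (set X), (forall n, open_cover (C n)) ->
  exists F : nat -> set (set X),
    (forall n, finite_set (F n) /\ F n `<=` C n) /\
    \bigcup_n \bigcup_(A in F n) A = [set: X].

Definition Hurewicz (X : topologicalType) : Prop :=
  forall C : nat -> set (set X), (forall n, open_cover (C n)) ->
  exists F : nat -> set (set X),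
    (forall n, finite_set (F n) /\ F n `<=` C n) /\
    forall x : X, \forall n \near \oo, (\bigcup_(A in F n) A) x.

Definition Rothberger (X : topologicalType) : Prop :=
  forall C : nat -> set (set X), (forall n, open_cover (C n)) ->
  exists A : nat -> set X,
    (forall n, C n (A n)) /\ \bigcup_n A n = [set: X].

(* Only abelian groups occur here, so boundedness is stated additively: the
   product F_n . U_n is the Minkowski sum. As in the usual convention, a
   neighborhood of the unit need not be open. *)
Definition Menger_bounded (G : topologicalZmodType) : Prop :=
  forall U : nat -> set G, (forall n, nbhs (0 : G) (U n)) ->
  exists F : nat -> set G, (forall n, finite_set (F n)) /\
    \bigcup_n [set a + u | a in F n & u in U n] = [set: G].

Definition Hurewicz_bounded (G : topologicalZmodType) : Prop :=
  forall U : nat -> set G, (forall n, nbhs (0 : G) (U n)) ->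
  exists F : nat -> set G, (forall n, finite_set (F n)) /\
    forall g : G, \forall n \near \oo, [set a + u | a in F n & u in U n] g.

Definition Rothberger_bounded (G : topologicalZmodType) : Prop :=
  forall U : nat -> set G, (forall n, nbhs (0 : G) (U n)) ->
  exists a : nat -> G, \bigcup_n [set a n + u | u in U n] = [set: G].

Definition ZN : Type := {ptws nat -> discrete_topology int}.

HB.instance Definition _ := Topological.on ZN.
HB.instance Definition _ := GRing.Zmodule.copy ZN (nat -> int).

Lemma continuous_ptws_discrete (I : Type) (T : choiceType) (X : topologicalType)
    (f : X -> {ptws I -> discrete_topology T}) :
  (forall i x, nbhs x [set y | f y i = f x i]) -> continuous f.
Proof.
move=> fi x; apply: (iffRL (cvg_sup _ _ _)) => i; move: x.
apply: continuous_comp_initial => x A /principal_filterP xA.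
by apply: filterS (fi i x) => y /= ->.
Qed.

Lemma nbhs_ptws_discrete (I : eqType) (T : choiceType)
    (f : {ptws I -> discrete_topology T}) (i : I) : nbhs f [set g | g i = f i].
Proof.
exact: (@proj_continuous I (fun=> discrete_topology T) i f [set f i]
  (@discrete_set1 (discrete_topology T) (f i))).
Qed.

Lemma ZN_sub_continuous : continuous (fun x : ZN * ZN => x.1 - x.2).
Proof.
apply: continuous_ptws_discrete => i x.
exists ([set z : ZN | z i = x.1 i], [set z : ZN | z i = x.2 i]).
  by split; exact: nbhs_ptws_discrete.
move=> y [/= y1 y2]; change (y.1 i - y.2 i = x.1 i - x.2 i :> int).
by rewrite y1 y2.
Qed.

HB.instance Definition _ :=
  PreTopologicalNmodule_isTopologicalZmodule.Build ZN ZN_sub_continuous.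

Definition subgroup (G : topologicalZmodType) (H : zmodClosed G) : Type :=
  {x : G | x \in H}.

Section Subgroup.
Variables (G : topologicalZmodType) (H : zmodClosed G).

HB.instance Definition _ := SubChoice.on (subgroup H).
HB.instance Definition _ := [SubChoice_isSubZmodule of subgroup H by <:].
HB.instance Definition _ := Topological.copy (subgroup H)
  (initial_topology (\val : subgroup H -> G)).

Lemma subgroup_sub_continuous :
  continuous (fun x : subgroup H * subgroup H => x.1 - x.2).
Proof.
apply: continuous_comp_initial => x.
rewrite (_ : _ \o _ = fun y : subgroup H * subgroup H => \val y.1 - \val y.2).
  have cval : continuous (\val : subgroup H -> G) by exact: initial_continuous.
  apply: (@continuous_comp _ _ _
    (fun y : subgroup H * subgroup H => (\val y.1, \val y.2))
    (fun z : G * G => z.1 - z.2)); last exact: sub_continuous.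
  have c1 : \val y.1 @[y --> x] --> \val x.1.
    by apply: (@cvg_comp _ _ _ fst \val _ (nbhs x.1)); [exact: cvg_fst|exact: cval].
  have c2 : \val y.2 @[y --> x] --> \val x.2.
    by apply: (@cvg_comp _ _ _ snd \val _ (nbhs x.2)); [exact: cvg_snd|exact: cval].
  exact: cvg_pair c1 c2.
by apply/funext => y; exact: (raddfB (\val : subgroup H -> G)).
Qed.

HB.instance Definition _ :=
  PreTopologicalNmodule_isTopologicalZmodule.Build (subgroup H)
    subgroup_sub_continuous.

End Subgroup.

(* Main.v *)
From HB Require Import structures.
Require Import Defs.
From mathcomp Require Import all_boot all_order all_algebra.
From mathcomp Require Import all_classical all_reals all_analysis.
From mathcomp Require Import wochoice zify.

(** [H] consists of the sequences whose odd part is bounded and whose even part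
    lies in a group [P] generated by 0/1 sequences. Elements of [H] are bounded,
    hence [H] is Hurewicz-bounded; its odd part contains the Cantor set, hence
    [H] is not Rothberger-bounded. The bounded odd part is sigma-compact, so the
    Menger property of [H] reduces to a combinatorial property of [P].

    The generators are indexed by a well-ordered set [D] of order type b, on
    which there is an unbounded family [F : D -> N^N].
    - If no family indexed by [D] is dominating (b < d), the generators code the
      functions [F s] on N x N; [P] is Menger because it is a union of fewer than
      d points.
    - Otherwise b = d and [F] can be taken to be a dominating scale. Fix a
      nonprincipal ultrafilter [U]. Each [F s] cuts N into intervals, and the
      [s]-th generator vanishes on long blocks met by [U] while it is constantly
      1 on infinitely many other long blocks. The former makes [P] concentrated,
      modulo [U], on the finitely supported sequences, which gives the Menger
      property for all finite sums because [U] is a filter; the latter, with the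
      fact that members of [P] vanish on a set of [U], refutes Hurewicz. *)

Set Implicit Arguments.
Unset Strict Implicit.
Unset Printing Implicit Defensive.

Import GRing.Theory.
Local Open Scope classical_set_scope.
Local Open Scope ring_scope.

(** * Families of functions and eventual domination *)

Definition eventually_le (f g : nat -> nat) : Prop :=
  \forall n \near \oo, (f n <= g n)%N.

Lemma eventually_le_trans f g h :
  eventually_le f g -> eventually_le g h -> eventually_le f h.
Proof. by apply: filterS2 => n; exact: leq_trans. Qed.

Lemma eventually_le_maxl f g : eventually_le f (fun n => maxn (f n) (g n)).
Proof. by apply: nearW => n; exact: leq_maxl. Qed.

Lemma eventually_le_maxr f g : eventually_le g (fun n => maxn (f n) (g n)).
Proof. by apply: nearW => n; exact: leq_maxr. Qed.

Lemma not_eventually_le f g :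
  ~ eventually_le f g -> forall N, exists2 n, (N <= n)%N & (g n < f n)%N.
Proof.
move=> fg N; apply: contrapT => H; apply: fg; exists N => // n /= Nn.
by rewrite leqNgt; apply/negP => ?; apply: H; exists n.
Qed.

(* Equivalently, the cardinality of [A] is below the bounding number b. *)
Definition small (I : Type) (A : set I) : Prop :=
  forall phi : I -> nat -> nat,
  exists h, forall i, A i -> eventually_le (phi i) h.

Lemma small_sub I (A B : set I) : A `<=` B -> small B -> small A.
Proof. by move=> AB sB phi; have [h hB] := sB phi; exists h => i /AB/hB. Qed.

Lemma small_set1 I (i : I) : small [set i].
Proof. by move=> phi; exists (phi i) => _ ->; apply: nearW. Qed.

Lemma small_setU I (A B : set I) : small A -> small B -> small (A `|` B).
Proof.
move=> sA sB phi; have [[f fA] [g gB]] := (sA phi, sB phi).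
exists (fun n => maxn (f n) (g n)) => i [/fA|/gB] /eventually_le_trans; apply.
  exact: eventually_le_maxl.
exact: eventually_le_maxr.
Qed.

Lemma small_bigcup J I (B : set J) (A : J -> set I) :
  small B -> (forall j, small (A j)) -> small (\bigcup_(j in B) A j).
Proof.
move=> sB sA phi; have /choice[f fA] := fun j => sA j phi.
have [h hB] := sB f; exists h => i [j /hB + /fA] => /[swap].
exact: eventually_le_trans.
Qed.

Lemma small_image I J (f : I -> J) (A : set I) : small A -> small (f @` A).
Proof.
by move=> sA phi; have [h hA] := sA (phi \o f); exists h => _ [i /hA + <-].
Qed.

(** Diagonal bound: [phi i] lies below the maximum from [n = i] on. *)
Lemma small_nat : small [set: nat].
Proof.
move=> phi; exists (fun n => \max_(i < n.+1) phi i n) => i _.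
exists i => // n /= leq_in.
by apply: (bigmax_sup (inord i)) => //; rewrite inordK.
Qed.

(** Lists of a fixed length are handled by induction on the length, and there are only countably
    many lengths. *)
Lemma small_seq (I : eqType) (A : set I) :
  small A -> small [set L : seq I | [set` L] `<=` A].
Proof.
move=> sA; pose S m := [set L : seq I | size L = m /\ [set` L] `<=` A].
have sS m : small (S m).
  elim: m => [|m IHm].
    by apply: (small_sub _ (small_set1 [::])) => L [/size0nil].
  have H i : small (cons i @` S m) by exact: small_image.
  apply: small_sub (small_bigcup sA H) => -[[]//|i L [[sL] LA]]; exists i.
    by apply: LA; rewrite /= inE eqxx.
  by exists L => //; split=> // j jL; apply: LA; rewrite /= inE orbC [j \in L]jL.
by apply: small_sub (small_bigcup small_nat sS) => L LA; exists (size L).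
Qed.

(* The initial segments of [D] stand for the cardinals below b. *)
Lemma minimal_non_small : exists (D : choiceType) (R : rel D),
  [/\ total R, transitive R, ~ small [set: D] & forall s, small [set t | R t s]].
Proof.
pose W : choiceType := (nat -> nat)%type.
have [R0 woR0] := well_ordering_principle W.
have R0min (A : set W) : A !=set0 ->
    exists2 p, A p & forall q, A q -> R0 p q.
  move=> [a Aa].
  have [|p [[pA minp] _]] := woR0 (fun x => `[< A x >]); first by exists a; apply/asboolP.
  by exists p; [exact/asboolP|move=> q Aq; apply: minp; apply/asboolP].
have R0tot : total R0.
  move=> a b; have [|p pab minp] := R0min [set a; b]; first by exists a; left.
  case: pab => <-; apply/orP; first by left; apply: minp; right.
  by right; apply: minp; left.
have R0refl p : R0 p p by have := R0tot p p; rewrite orbb.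
have R0anti p t : R0 p t -> R0 t p -> t = p.
  move=> pt tp; have [|q [_ uq]] := woR0 (fun x => x \in [:: p; t]).
    by exists p; rewrite inE eqxx.
  have Hp : minimum_of R0 (fun x => x \in [:: p; t]) p.
    by split=> [|x]; [rewrite inE eqxx|rewrite !inE => /orP[] /eqP ->].
  have Ht : minimum_of R0 (fun x => x \in [:: p; t]) t.
    by split=> [|x]; [rewrite !inE eqxx orbT|rewrite !inE => /orP[] /eqP ->].
  by rewrite -(uq _ Ht); exact: uq.
have R0trans : transitive R0.
  move=> b a c ab bc; have [|p pabc minp] := R0min [set a; b; c].
    by exists a; left; left.
  have [pa pb pc] : [/\ R0 p a, R0 p b & R0 p c].
    by split; apply: minp; [left; left|left; right|right].
  case: pabc => [[|]|] pE; rewrite pE // in pa pb pc.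
    by rewrite (R0anti _ _ pa ab).
  by rewrite (R0anti _ _ bc pb).
have nsW : ~ small [set: W].
  move=> /(_ (fun f n => (f n).+1))[h /(_ h I)[N _ /(_ N (leqnn N))]] /=.
  by rewrite ltnn.
(* [D] is all of [W] if every initial segment is small; otherwise it consists of the strict
   predecessors of the least [p] whose initial segment is not small. *)
have [D nsD sD] : exists2 D : set W, ~ small D &
    forall s, D s -> small [set t | D t /\ R0 t s].
  have [H|] := pselect (forall p, small [set t | R0 t p]).
    by exists setT => // s _; apply: small_sub (H s) => t [].
  move=> /existsNP H; have [p nsp minp] := R0min _ H.
  exists [set t | ~ R0 p t].
    move=> sp; apply: nsp; apply: small_sub (small_setU sp (small_set1 p)) => t /= tp.
    have [pt|] := pselect (R0 p t); last by left.
    by right; exact: R0anti.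
  move=> s /= ps; apply: contrapT => H'; apply: ps; apply: minp => /= sH'.
  by apply: H'; apply: small_sub sH' => t [].
exists (set_type D : choiceType), (fun s t => R0 (val s) (val t)); split.
- by move=> s t; exact: R0tot.
- by move=> t s u; exact: R0trans.
- move=> sD'; apply: nsD; apply: small_sub (small_image val sD') => t Dt.
  by exists (exist _ t (mem_set Dt)).
- move=> s phi.
  have [h hP] := sD _ (set_mem (valP s)) (fun t => oapp phi (fun=> 0%N) (insub t)).
  exists h => t ts; have := hP (val t); rewrite valK /=; apply.
  by split=> //; exact: set_mem (valP t).
Qed.

Lemma small_signed J (A : set J) :
  small A -> small [set i : bool * J | A i.2].
Proof.
move=> sA; have H b : small (pair b @` A) by exact: small_image.
apply: (@small_sub _ _ (pair true @` A `|` pair false @` A)) => [[[] j] Aj|].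
- by left; exists j.
- by right; exists j.
- exact: small_setU.
Qed.

(** * The Menger property of groups generated by 0/1 sequences *)

(* [C n p k] stands for: the sequences that agree with [p] below [k] are covered
   by finitely many members of the [n]-th cover. *)
Definition combinatorially_Menger (P : set (nat -> int)) : Prop :=
  forall C : nat -> (nat -> int) -> nat -> Prop,
    (forall n p j k, (j <= k)%N -> C n p j -> C n p k) ->
    (forall n p q k, (forall i, (i < k)%N -> p i = q i) -> C n p k -> C n q k) ->
    (forall p, P p -> forall n, exists k, C n p k) ->
  exists h : nat -> nat,
    forall p, P p -> forall N, exists2 n, (N <= n)%N & C n p (h n).

Definition comb (I : Type) (T : I -> nat -> int) (L : seq I) : nat -> int :=
  fun n => \sum_(i <- L) T i n.

Definition zspan (I : Type) (T : I -> nat -> int) : set (nat -> int) :=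
  range (comb T).

(** The sums over lists in [A j] form a small family, so one function [psi j] eventually bounds
    their requirements. A function [h] that no [psi j] eventually dominates serves every sum
    infinitely often. *)
Lemma zspan_Menger_of_small (J : Type) (I : eqType) (A : J -> set I)
    (T : I -> nat -> int) :
  (forall j, small (A j)) -> (forall L : seq I, exists j, [set` L] `<=` A j) ->
  (forall psi : J -> nat -> nat, exists h, forall j, ~ eventually_le h (psi j)) ->
  combinatorially_Menger (zspan T).
Proof.
move=> sA coverA nondom C Cmono Cloc CP.
have /choice[phi phiP] : forall Ln : seq I * nat, exists k, C Ln.2 (comb T Ln.1) k.
  by move=> [L n]; apply: CP; exists L.
have /choice[psi psiP] := fun j => small_seq (sA j) (fun L n => phi (L, n)).
have [h hP] := nondom psi; exists h => _ [L _ <-] N.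
have [j LA] := coverA L; have [N' _ N'P] := psiP j L LA.
have [n] := not_eventually_le (hP j) (maxn N N').
rewrite geq_max => /andP[Nn /N'P /= phin] /ltnW psin; exists n => //.
exact: Cmono (leq_trans phin psin) (phiP (L, n)).
Qed.

(** Values between [-n] and [n] are coded by ['I_n.*2.+1] with offset [n]. This finiteness takes the
    place of compactness of boxes. *)
Lemma finite_patterns (n m : nat) :
  exists (T : finType) (f : T -> nat -> int),
  forall p : nat -> int, (forall i, (i < m)%N -> (`|p i| <= n)%N) ->
  exists t, forall i, (i < m)%N -> f t i = p i.
Proof.
pose f (t : {ffun 'I_m -> 'I_n.*2.+1}) (i : nat) : int :=
  if insub i is Some i' then (t i')%:Z - n%:Z else 0.
exists {ffun 'I_m -> 'I_n.*2.+1}, f => p pn.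
exists [ffun i : 'I_m => inord (absz (p i + n%:Z))] => i im.
rewrite /f insubT ffunE /= inordK; first by have := pn i im; lia.
by have := pn i im; lia.
Qed.

Lemma finite_uniform_bound (T : eqType) (F : set T) (S : T -> nat -> Prop) :
  (forall x j k, (j <= k)%N -> S x j -> S x k) -> finite_set F ->
  (forall x, F x -> exists k, S x k) -> exists k, forall x, F x -> S x k.
Proof.
move=> Smono /finite_seqP[s ->]; elim: s => [|x s IHs] H; first by exists 0%N.
have [|k kP] := IHs; first by move=> y ys; apply: H; rewrite /= inE ys orbT.
have [|l lP] := H x; first by rewrite /= inE eqxx.
exists (maxn k l) => y /=; rewrite inE => /orP[/eqP ->|/kP].
  by apply: Smono lP; exact: leq_maxr.
by apply: Smono; exact: leq_maxl.
Qed.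

Lemma uniform_patch (n : nat) (S : (nat -> int) -> nat -> Prop) :
  (forall q j k, (j <= k)%N -> S q j -> S q k) ->
  (forall q, exists k, S q k) ->
  exists k, forall q, (forall i, (i < n)%N -> (`|q i| <= 1)%N) ->
    (forall i, (n <= i)%N -> q i = 0) -> S q k.
Proof.
move=> Smono SP; have [T [f fP]] := finite_patterns 1 n.
pose g t i := if (i < n)%N then f t i else 0.
have [|||k kP] := @finite_uniform_bound _ [set: T] (fun t => S (g t)).
- by move=> t; exact: Smono.
- exact: finite_finset.
- by move=> t _; exact: SP.
exists k => q /fP[t tP] q0; have -> : q = g t; last exact: kP.
by apply/funext => i; rewrite /g; case: ltnP => [/tP|/q0].
Qed.

(* Induction on the length of the sums. For a generator [T i] with [i] outside
   the exceptional small set, [T i + p] agrees with a modification of [p] below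
   [n] on a long initial segment, for [U]-many [n]; so the covers are first
   refined to [C'], which handles all such modifications of [p] at once. The
   generators in the small set are treated one by one. *)
Lemma zspan_Menger_of_filter (I : choiceType) (T : I -> nat -> int)
    (U : set_system nat) (PU : ProperFilter U) :
  \oo `<=` U ->
  (forall i n, (`|T i n| <= 1)%N) ->
  (forall p q N, (forall n, (N <= n)%N -> p n = q n) -> zspan T p -> zspan T q) ->
  (forall h : nat -> nat, exists2 A : set I, small A &
    forall i, ~ A i ->
      U [set n | forall k, (n <= k)%N -> (k < h n)%N -> T i k = 0]) ->
  combinatorially_Menger (zspan T).
Proof.
move=> ooU T1 patch concT.
(* Fixing the length and asking for [U]-many [n] makes induction possible; the functions obtained
   for the various lengths are then dominated by a single one. *)
suff main m : forall C : nat -> (nat -> int) -> nat -> Prop,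
    (forall n p j k, (j <= k)%N -> C n p j -> C n p k) ->
    (forall n p q k, (forall i, (i < k)%N -> p i = q i) -> C n p k -> C n q k) ->
    (forall p, zspan T p -> forall n, exists k, C n p k) ->
  exists h : nat -> nat,
    forall L, size L = m -> U [set n | C n (comb T L) (h n)].
  move=> C Cmono Cloc CP.
  have /choice[h hP] := fun m => main m C Cmono Cloc CP.
  have [g gP] := small_nat h; exists g => _ [L _ <-] N.
  have H1 := hP _ L erefl; have H2 := ooU _ (gP (size L) Logic.I).
  have H3 : U [set n | (N <= n)%N] by apply: ooU; exists N.
  have [n [[/= Cn hg] Nn]] := filter_ex (filterI (filterI H1 H2) H3).
  by exists n => //; exact: Cmono hg Cn.
elim: m => [|m IHm] C Cmono Cloc CP.
  have /choice[h hP] := CP (comb T [::]) (ex_intro2 _ _ [::] Logic.I erefl).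
  by exists h => L /size0nil ->; apply: filterS filterT => n _; exact: hP.
pose C' n p k := (n <= k)%N /\ forall q : nat -> int,
  (forall i, (i < n)%N -> (`|q i| <= 1)%N) ->
  (forall i, (n <= i)%N -> q i = 0) -> C n (fun i => p i + q i) k.
have [||p sp n|h' h'P] := IHm C'.
- move=> n p j k jk [nj H]; split; first exact: leq_trans jk.
  by move=> q q1 q0; apply: Cmono jk _; exact: H.
- move=> n p q k pq [nk H]; split=> // r r1 r0.
  by apply: Cloc (H r r1 r0) => i ik; rewrite pq.
- have [||k kP] := @uniform_patch n (fun q k => (forall i, (n <= i)%N -> q i = 0) ->
    C n (fun i => p i + q i) k).
  + by move=> q j k jk H q0; apply: Cmono jk _; exact: H.
  + move=> q; have [q0|q0] := pselect (forall i, (n <= i)%N -> q i = 0);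
      last by exists 0%N.
    have [|k kP] := CP (fun i => p i + q i) _ n; last by exists k.
    by apply: (patch p _ n) => // i /q0 ->; rewrite addr0.
  + exists (maxn n k); split; first exact: leq_maxl.
    by move=> q q1 q0; apply: Cmono (leq_maxr _ _) _; exact: kP.
have [A sA AP] := concT h'.
have zspanD i p : zspan T p -> zspan T (fun n => p n + T i n).
  move=> [L _ <-]; exists (i :: L) => //; apply/funext => n.
  by rewrite /comb big_cons addrC.
(* For a single generator, the induction hypothesis is applied to the cover translated by [T i]. *)
have /choice[hi hiP] : forall i, exists h : nat -> nat, forall L, size L = m ->
    U [set n | C n (comb T (i :: L)) (h n)].
  move=> i; have [||p sp n|h hP] := IHm (fun n p k => C n (fun x => p x + T i x) k).
  - by move=> n p; exact: Cmono.
  - by move=> n p q k pq; apply: Cloc => x xk; rewrite pq.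
  - by apply: CP; exact: zspanD.
  - exists h => L /hP; apply: filterS => n; apply: Cloc => x _.
    by rewrite /comb big_cons addrC.
(* Since [A] is small, one function handles all exceptional generators. *)
have [hA hAP] := sA hi.
exists (fun n => maxn (h' n) (hA n)) => -[//|i L] [sL].
have [Ai|nAi] := pselect (A i).
  apply: filterS (filterI (hiP i L sL) (ooU _ (hAP i Ai))) => n [/= + le].
  by apply: Cmono; rewrite (leq_trans le) ?leq_maxr.
apply: filterS (filterI (h'P L sL) (AP i nAi)) => n [/= [nh' H] T0].
apply: (Cmono _ _ _ _ (leq_maxl _ _)).
(* The modification is [T i] cut off at [n]; it agrees with [T i] below [h' n] because [T i]
   vanishes from [n] up to there. *)
apply: Cloc (H (fun k => if (k < n)%N then T i k else 0) _ _) => k.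
- move=> kh'; rewrite /comb big_cons addrC; congr (_ + _).
  by case: ltnP => // nk; rewrite T0.
- by move=> ->; exact: T1.
- by rewrite leqNgt => /negbTE ->.
Qed.

(** * Signed generators and finite modifications *)

(** With the sign in the index, flipping it negates a generator, so finite sums without coefficients
    already form a group. *)
Definition signed (J : Type) (t : J -> nat -> bool) (i : bool * J) (n : nat) : int :=
  (-1) ^+ i.1 * (t i.2 n)%:R.

Lemma signed_le1 J (t : J -> nat -> bool) i n : (`|signed t i n| <= 1)%N.
Proof. by case: i => -[] j; rewrite /signed /=; case: (t j n). Qed.

Lemma comb_cons I (T : I -> nat -> int) i L n :
  comb T (i :: L) n = T i n + comb T L n.
Proof. exact: big_cons. Qed.

Lemma zspan0 I (T : I -> nat -> int) : zspan T (fun=> 0).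
Proof. by exists [::] => //; apply/funext => n; rewrite /comb big_nil. Qed.

Lemma zspan_signedB J (t : J -> nat -> bool) p q :
  zspan (signed t) p -> zspan (signed t) q ->
  zspan (signed t) (fun n => p n - q n).
Proof.
move=> [L _ <-] [M _ <-]; exists (L ++ [seq (~~ i.1, i.2) | i <- M]) => //.
apply/funext => n; rewrite /comb big_cat big_map /=; congr (_ + _).
rewrite -sumrN; apply: eq_bigr => -[[] j] _; rewrite /signed /=.
  by rewrite expr0 expr1 mulN1r mul1r opprK.
by rewrite expr0 expr1 mulN1r mul1r.
Qed.

Lemma zspan_signed_bounded J (t : J -> nat -> bool) p :
  zspan (signed t) p -> exists K, forall n, (`|p n| <= K)%N.
Proof.
move=> [L _ <-]; exists (size L) => n; elim: L => [|i L IHL].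
  by rewrite /comb big_nil.
by rewrite comb_cons /=; have := signed_le1 t i n; lia.
Qed.

(* The spikes make the generated group closed under finite modifications. *)
Definition spikes (D : Type) (t : D -> nat -> bool) (j : D + nat) (n : nat) : bool :=
  match j with inl s => t s n | inr k => n == k end.

(** Values are corrected one at a time: the spike at [N] is added as often as the absolute value of
    [q N - p N] says, with the sign of that difference. *)
Lemma zspan_spikes_patch D (t : D -> nat -> bool) p q N :
  (forall n, (N <= n)%N -> p n = q n) ->
  zspan (signed (spikes t)) p -> zspan (signed (spikes t)) q.
Proof.
elim: N p => [|N IHN] p pq sp.
  by have <- : p = q by apply/funext => n; exact: pq.
apply: (IHN (fun n => p n + (q N - p N) * (n == N)%:R)).
  move=> n; rewrite leq_eqVlt => /orP[/eqP <-|Nn]; first by rewrite eqxx mulr1; lia.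
  by rewrite gtn_eqF // mulr0 addr0 pq.
have add (c : bool) p' : zspan (signed (spikes t)) p' ->
    zspan (signed (spikes t)) (fun n => p' n + (-1) ^+ c * (n == N)%:R).
  move=> [L _ <-]; exists ((c, inr N) :: L) => //.
  by apply/funext => n; rewrite comb_cons addrC.
have addn (c : bool) m : zspan (signed (spikes t))
    (fun n => p n + (-1) ^+ c * m%:R * (n == N)%:R).
  elim: m => [|m /(add c)]; first by under eq_fun do rewrite mulr0 mul0r addr0.
  congr zspan; apply/funext => n.
  by rewrite -addrA -mulrDl -natr1 mulrDr mulr1.
by have := addn (q N - p N < 0) (absz (q N - p N)); rewrite natz -intEsign.
Qed.

(** * Ultrafilters and interval partitions *)

Lemma ultrafilter_mod3 (U : set_system nat) (UU : UltraFilter U) (f : nat -> nat) :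
  exists2 r, (r < 3)%N & U [set n | (f n %% 3)%N = r].
Proof.
have [U0|U0] := in_ultra_setVsetC [set n | (f n %% 3)%N = 0%N] UU; first by exists 0%N.
have [U1|U1] := in_ultra_setVsetC [set n | (f n %% 3)%N = 1%N] UU; first by exists 1%N.
exists 2 => //; apply: filterS (filterI U0 U1) => n [/=].
by case: (f n %% 3)%N (ltn_pmod (f n) (isT : 0 < 3)%N) => [|[|[|]]].
Qed.

(** Iterating a monotone majorant [G] of [F] cuts the naturals into intervals, and [U] selects a
    residue [r] of the interval index modulo 3. From a point of a selected interval, the block up to
    [F n] meets only that interval and the next, where [t] vanishes. The third class carries the
    ones; its intervals contain the blocks from their left endpoints. *)
Lemma ultrafilter_gaps (U : set_system nat) (UU : UltraFilter U) (F : nat -> nat) :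
  exists t : nat -> bool,
    U [set n | forall k, (n <= k)%N -> (k < F n)%N -> t k = false] /\
    forall N, exists2 n, (N <= n)%N &
      forall k, (n <= k)%N -> (k < F n)%N -> t k.
Proof.
pose G n := (\sum_(i < n.+1) (F i).+1)%N.
have GS n : G n.+1 = (G n + (F n.+1).+1)%N by rewrite /G big_ord_recr.
have Gmono : {homo G : m n / (m <= n)%N}.
  by apply: homo_leq leq_trans _ => // n; rewrite GS leq_addr.
have ltG n : (n < G n)%N.
  by elim: n => [|n IHn]; [rewrite /G big_ord1|rewrite GS; lia].
have FG n : (F n <= G n)%N by rewrite /G big_ord_recr /=; lia.
(* [idx n] is the interval of the partition [x 0 < x 1 < ...] containing [n],
   so [F n <= x (idx n).+2]. *)
pose x j := iter j G 0%N.
have xmono : {homo x : i j / (i <= j)%N}.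
  by apply: homo_leq leq_trans _ => // j; apply: ltnW; exact: ltG.
have lex j : (j <= x j)%N by elim: j => // j IHj; exact: leq_ltn_trans (ltG _).
have /choice[idx idxP] : forall n, exists j, (x j <= n < x j.+1)%N.
  elim=> [|n [j /andP[jn nj]]]; first by exists 0%N => /=; exact: ltG.
  have [?|?] := ltnP n.+1 (x j.+1); first by exists j; lia.
  by exists j.+1; have := ltG (x j.+1); rewrite -[G (x _)]/(x j.+2); lia.
have idx_ge i n : (x i <= n)%N -> (i <= idx n)%N.
  move=> xin; rewrite leqNgt; apply/negP => /xmono.
  by have /andP[] := idxP n; lia.
have idx_lt i n : (n < x i)%N -> (idx n < i)%N.
  move=> nxi; rewrite ltnNge; apply/negP => /xmono.
  by have /andP[] := idxP n; lia.
have [r r3 Ur] := ultrafilter_mod3 UU idx.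
exists (fun k => idx k %% 3 == (r + 2) %% 3)%N; split.
  apply: filterS Ur => n /= nr k nk kF; have /andP[xn nx] := idxP n.
  have := idx_ge _ _ (leq_trans xn nk).
  have : (k < x (idx n).+2)%N.
    by apply: leq_trans kF (leq_trans (FG n) _); exact: Gmono (ltnW nx).
  by move=> /idx_lt; lia.
move=> N; exists (x (3 * N + r + 2)%N); first by apply: leq_trans (lex _); lia.
move=> k /idx_ge + kF.
have : (k < x (3 * N + r + 2).+1)%N by apply: leq_trans kF (FG _).
by move=> /idx_lt; lia.
Qed.

(** * The combinatorial group, in both cases *)

(** The last two clauses concern the function sending [n] to the least [i] with [p (e n i) = 0]: it
    is total for each [p] in [P], and these functions form an unbounded family. *)
Theorem exists_combinatorial_group :
  exists (P : set (nat -> int)) (e : nat -> nat -> nat),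
  [/\ P (fun=> 0), forall p q, P p -> P q -> P (fun n => p n - q n),
    forall p, P p -> exists K, forall n, (`|p n| <= K)%N,
    combinatorially_Menger P &
    (forall p, P p -> forall n, exists i, p (e n i) = 0) /\
    (forall h : nat -> nat, exists2 p, P p & forall N, exists2 n, (N <= n)%N &
      forall i, (i <= h n)%N -> p (e n i) <> 0)].
Proof.
have [D [R [Rtot Rtrans nsD sD]]] := minimal_non_small.
have [[phi phiP]|nodom] := pselect
    (exists phi : D -> nat -> nat, forall h, exists s, eventually_le h (phi s)).
- (* b = d *)
  (* [f s] eventually dominates all [phi t] with [R t s], so a function below [phi s0] is below
     [f s] for all later [s]. *)
  have /choice[f fP] := fun s => sD s phi.
  have [U [UU ooU]] := ultraFilterLemma eventually_filter.
  (* The maximum with [n.+1] puts [n] itself into the block, so each [t s] vanishes at [U]-many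
     points. *)
  have /choice[t tP] := fun s => ultrafilter_gaps UU (fun n => maxn n.+1 (f s n)).
  exists (zspan (signed (spikes t))), addn; split.
  + exact: zspan0.
  + exact: zspan_signedB.
  + exact: zspan_signed_bounded.
  + apply: (@zspan_Menger_of_filter _ _ U) => //.
    * exact: signed_le1.
    * exact: zspan_spikes_patch.
    * move=> h; have [s0 hs0] := phiP h.
      (* The exceptional generators are those up to [s0] and the spikes. *)
      exists [set i | ([set inl s | s in [set s | R s s0]] `|` range inr) i.2].
        apply: small_signed; apply: small_setU; first exact: small_image.
        exact: small_image small_nat.
      move=> [b [s|k]] nA; last by case: nA; right; exists k.
      have s0s : R s0 s.
        by have /orP[//|ss0] := Rtot s0 s; case: nA; left; exists s.
      have hf := ooU _ (eventually_le_trans hs0 (fP s s0 s0s)).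
      apply: filterS (filterI hf (tP s).1) => n [/= hfn tn] k nk kh.
      by rewrite /signed /= tn ?mulr0 //; lia.
  + split=> [_ [L _ <-] n|h].
      have UL : U [set m | comb (signed (spikes t)) L m = 0].
        elim: L => [|[b j] L IHL].
          by apply: filterS filterT => m _; rewrite /= /comb big_nil.
        have Uj : U [set m | spikes t j m = false].
          case: j => [s|k].
            by apply: filterS (tP s).1 => m /=; apply=> //; rewrite leq_max leqnn.
          by apply: ooU; exists k.+1 => // m /= km; rewrite gtn_eqF.
        apply: filterS (filterI IHL Uj) => m [/= Lm jm].
        by rewrite comb_cons Lm /signed /= jm mulr0 addr0.
      have Un : U [set m | (n <= m)%N] by apply: ooU; exists n.
      have [m [/= Lm nm]] := filter_ex (filterI UL Un).
      by exists (m - n)%N; rewrite subnKC.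
    have [s0 hs0] := phiP (fun n => (n + h n).+1).
    exists (signed (spikes t) (false, inl s0)).
      by exists [:: (false, inl s0)] => //; apply/funext => n; rewrite /comb big_seq1.
    move=> N; have s0s0 : R s0 s0 by have := Rtot s0 s0; rewrite orbb.
    have [M _ hM] := eventually_le_trans hs0 (fP s0 s0 s0s0).
    have [n] := (tP s0).2 (maxn N M); rewrite geq_max => /andP[Nn /hM /= hn] tn.
    exists n => // i ih; rewrite /signed /= tn ?leq_addr //.
    by rewrite leq_max; apply/orP; right; lia.
- (* b < d *)
  have [F FP] : exists F : D -> nat -> nat,
      forall h, exists s, ~ eventually_le (F s) h.
    move: nsD => /existsNP[F /forallNP FP]; exists F => h.
    by have /existsNP[s /not_implyP[_ sP]] := FP h; exists s.
  (* Pairing function, decoded by [logn 2]. *)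
  pose e k i := (2 ^ k * i.*2.+1)%N.
  pose t s m := ((m %/ 2 ^ logn 2 m)./2 < F s (logn 2 m))%N.
  have te s k i : t s (e k i) = (i < F s k)%N.
    have le : logn 2 (e k i) = k.
      rewrite lognM ?expn_gt0 // pfactorK // logn_coprime ?addn0 //.
      by rewrite coprime2n /= odd_double.
    by rewrite /t le mulKn ?expn_gt0 // /= uphalf_double.
  exists (zspan (signed t)), e; split.
  + exact: zspan0.
  + exact: zspan_signedB.
  + exact: zspan_signed_bounded.
  + apply: (@zspan_Menger_of_small D _ (fun s => [set i | R i.2 s])).
    * by move=> s; exact: small_signed (sD s).
    (* A finite list lies below its [R]-greatest index; for the empty list any element of [D] will
       do. *)
    * elim=> [|[b s] L [s' Ls']].
        by have [s _] := FP (fun=> 0%N); exists s.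
      have [ss'|s's] := orP (Rtot s s').
        exists s' => i /=; rewrite inE => /orP[/eqP -> //|]; exact: Ls'.
      exists s => i /=; rewrite inE => /orP[/eqP ->|/Ls' /Rtrans]; last exact.
      by have := Rtot s s; rewrite orbb.
    * move=> psi; apply: contrapT => /forallNP H; apply: nodom; exists psi => h.
      by have /existsNP[s /contrapT sP] := H h; exists s.
  + split=> [_ [L _ <-] n|h].
      (* Each generator has finite support on the row [n]. *)
      have [M HM] : exists M, forall i, (M <= i)%N -> comb (signed t) L (e n i) = 0.
        elim: L => [|[b s] L [M HM]].
          by exists 0%N => i _; rewrite /comb big_nil.
        exists (maxn M (F s n)) => i; rewrite geq_max => /andP[Mi Fi].
        by rewrite comb_cons HM // /signed /= te ltnNge Fi mulr0 addr0.
      by exists M; exact: HM.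
    have [s sh] := FP h; exists (signed t (false, s)).
      by exists [:: (false, s)] => //; apply/funext => n; rewrite /comb big_seq1.
    move=> N; have [n Nn hn] := not_eventually_le sh N; exists n => // i ih.
    by rewrite /signed /= te (leq_ltn_trans ih hn).
Qed.

(** * Topology of subgroups *)

(** The sets containing a cylinder around [x] form a filter that converges to [x] in every
    coordinate, hence in the product. *)
Lemma nbhs_ZN_cylinder (x : ZN) (A : set ZN) :
  nbhs x A -> exists m, forall y : ZN, (forall i, (i < m)%N -> y i = x i) -> A y.
Proof.
pose B : set_system ZN := [set A | exists m, forall y : ZN,
  (forall i, (i < m)%N -> y i = x i) -> A y].
have FB : Filter B.
  split; first by exists 0%N.
  - move=> P Q [m mP] [n nQ]; exists (maxn m n) => y xy; split.
      by apply: mP => i im; apply: xy; rewrite leq_max im.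
    by apply: nQ => i im; apply: xy; rewrite leq_max im orbT.
  - by move=> P Q PQ [m mP]; exists m => y /mP/PQ.
suff : B --> x by apply.
apply/cvg_sup => i C; rewrite nbhsE => -[_ [[D _ <-] Dx] DC].
exists i.+1 => y xy; apply: DC; move: Dx; by rewrite /= /proj xy.
Qed.

Section SubgroupTopology.
Variable H : zmodClosed ZN.
Implicit Types (g : subgroup H) (A : set (subgroup H)).

Definition coord g (i : nat) : int := val g i.

Lemma coordD g g' i : coord (g + g') i = coord g i + coord g' i.
Proof. by []. Qed.

Lemma coordB g g' i : coord (g - g') i = coord g i - coord g' i.
Proof. by []. Qed.

Lemma nbhs_subgroup_cylinder g A :
  nbhs g A -> exists m, forall g',
    (forall i, (i < m)%N -> coord g' i = coord g i) -> A g'.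
Proof.
rewrite nbhsE => -[_ [[D oD <-] Dg] DA].
have [m mP] := nbhs_ZN_cylinder (open_nbhs_nbhs (conj oD Dg)).
by exists m => g' /mP Dg'; exact: DA.
Qed.

Lemma open_coordinate (i : nat) (V : set int) : open [set g : subgroup H | V (coord g i)].
Proof.
rewrite openE => g /= Vg.
have cval : continuous (val : subgroup H -> ZN) by exact: initial_continuous.
change (nbhs g [set g' : subgroup H | V (coord g' i)]).
have K : nbhs g [set g' : subgroup H | coord g' i = coord g i].
  exact: cval g _ (nbhs_ptws_discrete (val g) i).
by apply: (@filterS _ (nbhs g) _ _ _ _ K) => g' /= ->.
Qed.

End SubgroupTopology.

(** * Boundedness, and criteria refuting the other properties *)

Lemma Hurewicz_Menger_bounded (G : topologicalZmodType) :
  Hurewicz_bounded G -> Menger_bounded G.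
Proof.
move=> HG U /HG[F [finF FU]]; exists F; split=> //.
apply/seteqP; split=> // g _; have [N _ NP] := FU g.
by exists N => //; exact: NP (leqnn N).
Qed.

(** The [n]-th finite set represents all patterns on the first [m n] coordinates with values between
    [-n] and [n] that occur in [H]. An element bounded by [K] is caught from stage [K] on. *)
Lemma subgroup_Hurewicz_bounded (H : zmodClosed ZN) :
  (forall g : ZN, g \in H -> exists K, forall i, (`|g i : int| <= K)%N) ->
  Hurewicz_bounded (subgroup H).
Proof.
move=> Hb U U0; have /choice[m mP] := fun n => nbhs_subgroup_cylinder (U0 n).
have /choice[r rP] : forall n, exists F : set (subgroup H), finite_set F /\
    forall g : subgroup H, (forall i, (i < m n)%N -> (`|coord g i| <= n)%N) ->
    exists2 a, F a & forall i, (i < m n)%N -> coord g i = coord a i.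
  move=> n; have [T [f fP]] := finite_patterns n (m n).
  have /choice[r rP] : forall t, exists a : subgroup H, forall g : subgroup H,
      (forall i, (i < m n)%N -> f t i = coord g i) ->
      forall i, (i < m n)%N -> f t i = coord a i.
    move=> t; have [[a aP]|na] := pselect (exists g : subgroup H,
      forall i, (i < m n)%N -> f t i = coord g i); first by exists a.
    (* Patterns that do not occur in [H] get the default representative 0. *)
    by exists 0 => g gt; case: na; exists g.
  exists (range r); split; first exact/finite_image/finite_finset.
  move=> g /fP[t tP]; exists (r t) => // i im.
  by rewrite -(rP t g tP) // tP.
exists r; split=> [n|g]; first exact: (rP n).1.
have [K gK] := Hb _ (valP g); exists K => // n /= Kn.
have [|a ra aP] := (rP n).2 g; first by move=> i _; exact: leq_trans (gK i) Kn.
exists a => //; exists (g - a); last by rewrite addrC subrK.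
by apply: mP => i im; rewrite coordB aP // subrr.
Qed.

(** Diagonalization: the [n]-th translate prescribes the value at [e n], and a binary sequence can
    avoid all these values. *)
Lemma not_Rothberger_bounded_of_binary (H : zmodClosed ZN) (e : nat -> nat) :
  (forall b : nat -> bool, exists2 g, g \in H & forall n, g (e n) = (b n)%:R) ->
  ~ Rothberger_bounded (subgroup H).
Proof.
move=> He RH; have [n|a aP] := RH (fun n => [set g | coord g (e n) = 0]).
  by apply: open_nbhs_nbhs; split=> //; exact: (open_coordinate H (e n) [set 0]).
have [g gH gE] := He (fun n => coord (a n) (e n) == 0 :> int).
have : [set: subgroup H] (exist _ g gH) by [].
rewrite -aP => -[n _ [u /= un]] /(congr1 (fun g => coord g (e n))) /=.
rewrite coordD un addr0 [in RHS]/coord /= gE.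
by case: eqP => [->|//].
Qed.

Lemma not_Rothberger_of_binary (H : zmodClosed ZN) (e : nat -> nat) :
  (forall b : nat -> bool, exists2 g, g \in H & forall n, g (e n) = (b n)%:R) ->
  ~ Rothberger (subgroup H).
Proof.
move=> He RH.
have [n|A [AC AT]] := RH (fun n => range (fun v => [set g | coord g (e n) = v])).
  split; first by move=> _ [v _ <-]; exact: (open_coordinate H (e n) [set v]).
  apply/seteqP; split=> // g _.
  by exists [set g' | coord g' (e n) = coord g (e n)]; [exists (coord g (e n))|].
have /choice[v vP] : forall n, exists v, A n = [set g | coord g (e n) = v].
  by move=> n; have [v _ <-] := AC n; exists v.
have [g gH gE] := He (fun n => v n == 0 :> int).
have : [set: subgroup H] (exist _ g gH) by [].
rewrite -AT => -[n _]; rewrite vP /coord /= gE.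
by case: eqP => [->|v0 /esym].
Qed.

(** The covers [V n] increase in [m], so a finite subfamily amounts to a bound [h n] on the position
    of a zero; some [g] violates it for infinitely many [n]. *)
Lemma not_Hurewicz_of_zeros (H : zmodClosed ZN) (e : nat -> nat -> nat) :
  (forall g, g \in H -> forall n, exists i, g (e n i) = 0) ->
  (forall h : nat -> nat, exists2 g, g \in H &
    forall N, exists2 n, (N <= n)%N & forall i, (i <= h n)%N -> g (e n i) <> 0) ->
  ~ Hurewicz (subgroup H).
Proof.
move=> zeros nonzeros HH.
pose V n m : set (subgroup H) :=
  \bigcup_(i in [set i | (i <= m)%N]) [set g | coord g (e n i) = 0].
have [n|F [FC FP]] := HH (fun n => range (V n)).
  split.
    move=> _ [m _ <-]; apply: bigcup_open => i _.
    exact: (open_coordinate H (e n i) [set 0]).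
  apply/seteqP; split=> // g _; have [i gi] := zeros _ (valP g) n.
  by exists (V n i); [exists i|exists i => /=].
have /choice[h hP] : forall n, exists m, forall A, F n A -> A `<=` V n m.
  move=> n; apply: finite_uniform_bound (FC n).1 _.
    by move=> A j k jk AV g /AV[i ij gi]; exists i => //; exact: leq_trans jk.
  by move=> A /(FC n).2[m _ <-]; exists m.
have [g gH gn0] := nonzeros h; have [N _ NP] := FP (exist _ g gH).
have [n Nn gnh] := gn0 N; have [A FA Ag] := NP n Nn.
by have [i ih /=] := hP n A FA _ Ag; exact: gnh.
Qed.

(** * Interleaving [P] with the bounded sequences *)

Definition interleave (p q : nat -> int) : ZN :=
  fun i => if odd i then q i./2 else p i./2.

Lemma interleave_even p q i : interleave p q i.*2 = p i.
Proof. by rewrite /interleave odd_double doubleK. Qed.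

Lemma interleave_odd p q i : interleave p q i.*2.+1 = q i.
Proof. by rewrite /interleave /= odd_double /= uphalf_double. Qed.

Section Interleaved.
Variables (P : set (nat -> int)) (H : zmodClosed ZN).
Hypothesis HP : forall g : ZN, g \in H <->
  P (fun i => g i.*2) /\ exists K, forall i, (`|g i.*2.+1 : int| <= K)%N.

Lemma interleave_in p q K :
  P p -> (forall i, (`|q i| <= K)%N) -> interleave p q \in H.
Proof.
move=> Pp qK; apply/HP; split.
  have <- : p = (fun i => interleave p q i.*2) by
    apply/funext => i; rewrite interleave_even.
  exact: Pp.
by exists K => i; rewrite interleave_odd.
Qed.

Section Tube.
Variables (C : set (set (subgroup H))) (n : nat).
Hypothesis C_cover : open_cover C.

Let fin_covered (S : set (subgroup H)) : Prop :=
  exists F, [/\ finite_set F, F `<=` C & S `<=` \bigcup_(A in F) A].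

Let box (p : nat -> int) (k : nat) (s : seq int) : set (subgroup H) :=
  [set g | [/\ forall i, (i < k)%N -> coord g i.*2 = p i,
    forall i, (i < size s)%N -> coord g i.*2.+1 = s`_i &
    forall i, (`|coord g i.*2.+1| <= n)%N]].

(* Koenig's lemma on the finitely branching tree of the odd parts. *)
Lemma finitely_covered_tube (p : nat -> int) : P p ->
  exists k, fin_covered (box p k [::]).
Proof.
move=> Pp; apply: contrapT => nil_bad.
pose good s := exists k, fin_covered (box p k s).
have extend s : ~ good s -> exists v, (`|v| <= n)%N /\ ~ good (rcons s v).
  move=> bad; apply: contrapT => /forallNP noext; apply: bad.
  pose w (i : 'I_n.*2.+1) : int := i%:Z - n%:Z.
  have wP v : (`|v| <= n)%N -> exists i, w i = v.
    by move=> vn; exists (inord (absz (v + n%:Z))); rewrite /w inordK; lia.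
  have good_w i : good (rcons s (w i)).
    apply: contrapT => bad; apply: (noext (w i)); split=> //.
    by have := ltn_ord i; rewrite /w; lia.
  have /choice[k kP] := good_w; have /choice[F FP] := kP.
  exists (\max_i k i)%N, (\bigcup_i F i); split.
  - by apply: bigcup_finite => [|i _]; [exact: finite_finset|have [] := FP i].
  - by move=> A [i _]; have [_ + _] := FP i; exact.
  - move=> g [gp gs gn]; have [i wi] := wP _ (gn (size s)).
    have [_ _ /(_ g)[]] := FP i; last by move=> A FA Ag; exists A => //; exists i.
    split=> // [j jk|j]; first by apply: gp; rewrite (leq_trans jk) ?leq_bigmax.
    rewrite size_rcons ltnS leq_eqVlt nth_rcons => /orP[/eqP ->|js].
      by rewrite ltnn eqxx wi.
    by rewrite js gs.
have /choice[next nextP] : forall s, exists v,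
    ~ good s -> (`|v| <= n)%N /\ ~ good (rcons s v).
  move=> s; have [/extend[v vP]|gs] := pselect (~ good s); first by exists v.
  by exists 0.
pose branch j := iter j (fun s => rcons s (next s)) [::].
have bad j : ~ good (branch j) by elim: j => // j /nextP[].
pose q j := next (branch j).
have branchE j : branch j = mkseq q j.
  by elim: j => // j IHj; rewrite mkseqS -IHj.
have qn j : (`|q j| <= n)%N by have [] := nextP _ (bad j).
(* The infinite bad branch [q] defines a point of [H]. A single member of the cover contains a
   cylinder around it, which makes a finite stage of the branch good. *)
pose g : subgroup H := exist (fun x : ZN => x \in H) _ (interleave_in Pp qn).
have [openC coverC] := C_cover.
have : [set: subgroup H] g by [].
rewrite -coverC => -[A CA Ag].
have [m mP] := nbhs_subgroup_cylinder (open_nbhs_nbhs (conj (openC _ CA) Ag)).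
apply: (bad m); exists m, [set A]; split=> [|_ -> //|g' [g'p g'q _]].
  exact: finite_set1.
exists A => //; apply: mP => i im; have i2m : (i./2 < m)%N by lia.
rewrite -(odd_double_half i); case: (odd i); rewrite ?add1n ?add0n.
  by rewrite g'q branchE ?size_mkseq ?nth_mkseq // [RHS]interleave_odd.
by rewrite g'p // [RHS]interleave_even.
Qed.

End Tube.

(** Tubes over points of [P] turn the covers into the combinatorial covers [R]. At stage [n] only
    finitely many even patterns below [h n] are bounded by [n]; an element is caught at some stage
    beyond its bounds, as [h] succeeds infinitely often. *)
Lemma interleaved_Menger :
  (forall p, P p -> exists K, forall i, (`|p i| <= K)%N) ->
  combinatorially_Menger P -> Menger (subgroup H).
Proof.
move=> Pb PM C Ccov.
pose R n (p : nat -> int) k := exists F : set (set (subgroup H)),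
  [/\ finite_set F, F `<=` C n & forall g : subgroup H,
    (forall i, (i < k)%N -> coord g i.*2 = p i) ->
    (forall i, (`|coord g i.*2.+1| <= n)%N) -> (\bigcup_(A in F) A) g].
have [n p j k jk|n p q k pq|p Pp n|h hP] := PM R.
- case=> F [finF FC Fg]; exists F; split=> // g gp; apply: Fg => i ij.
  by apply: gp; exact: leq_trans jk.
- case=> F [finF FC Fg]; exists F; split=> // g gp; apply: Fg => i ij.
  by rewrite gp // pq.
- have [k [F [finF FC Fg]]] := finitely_covered_tube n (Ccov n) Pp.
  by exists k, F; split=> // g gp gn; exact: Fg.
have /choice[F FP] : forall n, exists F : set (set (subgroup H)),
    [/\ finite_set F, F `<=` C n & forall g : subgroup H,
    R n (fun i => coord g i.*2) (h n) -> (forall i, (`|coord g i| <= n)%N) ->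
    (\bigcup_(A in F) A) g].
  move=> n; have [T [f fP]] := finite_patterns n (h n).
  have /choice[F FP] : forall t, exists F : set (set (subgroup H)),
      [/\ finite_set F, F `<=` C n & R n (f t) (h n) -> forall g : subgroup H,
      (forall i, (i < h n)%N -> coord g i.*2 = f t i) ->
      (forall i, (`|coord g i.*2.+1| <= n)%N) -> (\bigcup_(A in F) A) g].
    move=> t; have [[F [finF FC Fg]]|nR] := pselect (R n (f t) (h n)); first by exists F.
    (* The empty family is the default for patterns without a finitely covered tube. *)
    by exists set0; split.
  exists (\bigcup_t F t); split.
  - by apply: bigcup_finite => [|t _]; [exact: finite_finset|have [] := FP t].
  - by move=> A [t _]; have [_ + _] := FP t; exact.
  - move=> g [G [finG GC Gg]] gn.
    have [|t tP] := fP (fun i => coord g i.*2); first by move=> i _; exact: gn.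
    have [_ _ /(_ _ g)[]] := FP t.
    + by exists G; split=> // g' g't; apply: Gg => i ih; rewrite g't // tP.
    + by move=> i ih; rewrite tP.
    + by move=> i; exact: gn.
    + by move=> A FA Ag; exists A => //; exists t.
exists F; split=> [n|]; first by have [] := FP n.
apply/seteqP; split=> // g _; have [Pg [K gK]] := (HP _).1 (valP g).
have [K' gK'] := Pb _ Pg; have [n] := hP _ Pg (maxn K K').
rewrite geq_max => /andP[Kn K'n] Rn; exists n => //; have [_ _] := FP n; apply=> // i.
rewrite -(odd_double_half i); case: (odd i); rewrite ?add1n ?add0n.
  exact: leq_trans (gK _) Kn.
exact: leq_trans (gK' _) K'n.
Qed.

End Interleaved.

(** * Assembling the subgroup *)

Theorem theorem9p9 :
  exists H : zmodClosed ZN,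
    [/\ Hurewicz_bounded (subgroup H),
        Menger_bounded (subgroup H)
      & Menger (subgroup H)] /\
    [/\ ~ Rothberger_bounded (subgroup H),
        ~ Hurewicz (subgroup H)
      & ~ Rothberger (subgroup H)].
Proof.
have [P [e [P0 PB Pb PM [zeros nonzeros]]]] := exists_combinatorial_group.
pose inH (g : ZN) := `[< P (fun i => g i.*2) /\
  exists K, forall i, (`|g i.*2.+1 : int| <= K)%N >].
have clH : zmod_closed inH.
  split=> [|f g /asboolP[Pf [K fK]] /asboolP[Pg [L gL]]]; apply/asboolP; split=> //.
  - by exists 0%N.
  - exact: PB.
  - by exists (K + L)%N => i; have := fK i; have := gL i;
      change ((`|(g i.*2.+1 : int)| <= L)%N -> (`|(f i.*2.+1 : int)| <= K)%N ->
        (`|(f i.*2.+1 - g i.*2.+1 : int)| <= K + L)%N); lia.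
pose H : zmodClosed ZN := HB.pack inH (GRing.isZmodClosed.Build ZN inH clH).
have HP (g : ZN) : g \in H <-> P (fun i => g i.*2) /\
  exists K, forall i, (`|g i.*2.+1 : int| <= K)%N by split=> /asboolP.
have Hb : Hurewicz_bounded (subgroup H).
  apply: subgroup_Hurewicz_bounded => g /HP[/Pb[K gK] [L gL]].
  exists (maxn K L) => i; rewrite -(odd_double_half i) leq_max.
  by case: (odd i); rewrite ?add1n ?add0n ?gK ?gL ?orbT.
have binary (b : nat -> bool) :
    exists2 g : ZN, g \in H & forall n, g n.*2.+1 = (b n)%:R.
  exists (interleave (fun=> 0) (fun n => (b n)%:R)).
    by apply: (interleave_in HP (K := 1)) => // i; case: (b i).
  by move=> n; rewrite interleave_odd.
exists H; split; split=> //.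
- exact: Hurewicz_Menger_bounded.
- exact: (interleaved_Menger HP).
- exact: (not_Rothberger_bounded_of_binary binary).
(* Doubling places the positions [e n i] on the even coordinates, which carry [P]. *)
- apply: (@not_Hurewicz_of_zeros H (fun n i => (e n i).*2)).
    by move=> g /HP[Pg _]; exact: zeros Pg.
  move=> h; have [p Pp pn0] := nonzeros h; exists (interleave p (fun=> 0)).
    by apply: (interleave_in HP (K := 0)).
  move=> N; have [n Nn pn] := pn0 N; exists n => // i ih.
  by rewrite interleave_even; exact: pn.
- exact: (not_Rothberger_of_binary binary).
Qed.
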